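(* Let $n\ge 2$, let $m_1\ge m_2\ge\cdots\ge m_n$ be positive integers, put $\tilde n=\sum_{i=1}^n m_i$, and let $\tilde{\mathcal A}$ be a multi-arrangement of $n$ points in $\mathbb{CP}^1$ with multiplicities $m_1,\ldots,m_n$, with defining polynomial $$\tilde Q=x^{m_1}y^{m_2}\prod_{i=3}^n(x-z_iy)^{m_i},$$ where $z_3,\ldots,z_n\in\mathbb C\setminus\{0\}$ are pairwise distinct. Let $Q=xy\prod_{i=3}^n(x-z_iy)$ and let $\theta_E=x\partial_x+y\partial_y$ be the Euler derivation. Suppose $\tilde n\le 2n-2$. Then the derivation $\theta_2=\frac{\tilde Q}{Q}\,\theta_E$ belongs to $D(\tilde{\mathcal A})$ and has minimal degree among the nonzero homogeneous elements of $D(\tilde{\mathcal A})$. In particular, the exponents of $\tilde{\mathcal A}$ are $$(e_1,e_2)=(\tilde n-n+1,\ n-1).$$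
   Context: Let $S=\mathbb C[x,y]$. A multi-arrangement $\tilde{\mathcal A}$ in $\mathbb{CP}^1$ is a set of $n\geq 2$ pairwise distinct points $p_1,\ldots,p_n$ of $\mathbb{CP}^1$ together with positive integer multiplicities $m_1,\ldots,m_n$; with linear forms $\alpha_i$ such that $\ker\alpha_i=p_i$, its defining polynomial is $\prod_i\alpha_i^{m_i}$. (Any multi-arrangement can be brought into the form in the claim, $\alpha_1=x$, $\alpha_2=y$, $\alpha_i=x-z_iy$ for $i\ge3$, by a choice of coordinates.) Its module of derivations is the graded $S$-module $$D(\tilde{\mathcal A})=\{\theta\in \mathrm{Der}_{\mathbb C}(S)\mid \theta(\alpha_i)\in\alpha_i^{m_i}S\ \text{ for all } i\}.$$ A nonzero derivation $f\partial_x+g\partial_y$ is homogeneous of degree $d$ if $f$ and $g$ are each zero or homogeneous polynomials of degree $d$. The module $D(\tilde{\mathcal A})$ is always free of rank 2 with a homogeneous basis; the degrees $e_1\le e_2$ of the elements of a homogeneous basis are uniquely determined, and $(e_1,e_2)$ is called the exponents of $\tilde{\mathcal A}$. *)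

(* Defs.v *)
From HB Require Import structures.
From mathcomp Require Import all_boot all_order all_algebra.
From mathcomp Require Import reals complex mpoly.

Set Implicit Arguments.
Unset Strict Implicit.
Unset Printing Implicit Defensive.

Import Order.TTheory GRing.Theory Num.Theory.
Local Open Scope ring_scope.

(* A realType is a complete ordered field, hence a copy of
   the real numbers, and R[i] is then the field of complex numbers. *)
Notation polyS R := {mpoly R[i][2]}.

Definition Sx (R : realType) : polyS R := 'X_(ord0 : 'I_2).
Definition Sy (R : realType) : polyS R := 'X_(ord_max : 'I_2).
Arguments Sx {R}.
Arguments Sy {R}.

Definition is_derivation (R : realType) (theta : polyS R -> polyS R) : Prop :=
  linear theta /\
  (forall p q, theta (p * q) = theta p * q + p * theta q).

(* f d/dx + g d/dy *)
Definition vfield (R : realType) (f g p : polyS R) : polyS R :=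
  f * p^`M(ord0 : 'I_2) + g * p^`M(ord_max : 'I_2).

Definition euler_der (R : realType) : polyS R -> polyS R := vfield Sx Sy.

(* Nonzero homogeneous derivations only: the zero polynomial is d.-homog for
   every d, so f and g may vanish, but not both. *)
Definition homog_der (R : realType) (d : nat)
    (theta : polyS R -> polyS R) : Prop :=
  exists f g : polyS R,
    [/\ theta =1 vfield f g, f \is d.-homog, g \is d.-homog &
        (f != 0) || (g != 0)].

(* D(A) for the multi-arrangement given by the forms alpha i with
   multiplicities m i. *)
Definition in_D (R : realType) (n : nat) (alpha : 'I_n -> polyS R)
    (m : 'I_n -> nat) (theta : polyS R -> polyS R) : Prop :=
  is_derivation theta /\
  (forall i, exists q, theta (alpha i) = q * alpha i ^+ m i).

Definition min_degree_in_D (R : realType) (n : nat) (alpha : 'I_n -> polyS R)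
    (m : 'I_n -> nat) (theta : polyS R -> polyS R) : Prop :=
  exists d, [/\ in_D alpha m theta, homog_der d theta &
    forall eta d', in_D alpha m eta -> homog_der d' eta -> (d <= d')%N].

Definition basis_of_D (R : realType) (n : nat) (alpha : 'I_n -> polyS R)
    (m : 'I_n -> nat) (theta1 theta2 : polyS R -> polyS R) : Prop :=
  [/\ in_D alpha m theta1, in_D alpha m theta2 &
    forall eta, in_D alpha m eta ->
      exists! ab : polyS R * polyS R,
        forall p, eta p = ab.1 * theta1 p + ab.2 * theta2 p].

(* D(A) is free of rank 2 with a homogeneous basis, whose degrees do not
   depend on the choice of that basis; hence the existential. *)
Definition has_exponents (R : realType) (n : nat) (alpha : 'I_n -> polyS R)
    (m : 'I_n -> nat) (e1 e2 : nat) : Prop :=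
  (e1 <= e2)%N /\
  exists theta1 theta2,
    [/\ basis_of_D alpha m theta1 theta2,
        homog_der e1 theta1 & homog_der e2 theta2].

(* The forms x, y, x - z_3 y, ..., x - z_n y.  Indices start at 0, so only the
   values z i with 2 <= i are used. *)
Definition std_form (R : realType) (n : nat) (z : 'I_n -> R[i])
    (i : 'I_n) : polyS R :=
  if i == 0%N :> nat then Sx
  else if i == 1%N :> nat then Sy
  else Sx - z i *: Sy.

(* Main.v *)
Require Import Defs.
From HB Require Import structures.
From mathcomp Require Import all_boot all_order all_algebra.
From mathcomp Require Import ring zify.
From mathcomp Require Import reals complex mpoly.

Set Implicit Arguments.
Unset Strict Implicit.
Unset Printing Implicit Defensive.

Import Order.TTheory GRing.Theory Num.Theory.
Local Open Scope ring_scope.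

(** The proof has two halves, both organised around the determinant
    det(theta, eta) = f g' - f' g of theta = f d/dx + g d/dy and
    eta = f' d/dx + g' d/dy.  If theta and eta lie in D, a linear form
    alpha = s x + t y gives s det = theta(alpha) g' - eta(alpha) g, and similarly
    for t, so alpha^m divides det; as the lines are distinct, the whole product
    Qt divides det ([in_D_det_dvd]).  Conversely two elements of D whose
    determinant is a nonzero scalar multiple of Qt form a basis, by Cramer's
    rule ([saito_criterion]).

    Minimality.  With all multiplicities lowered to 1, Q divides
    det(eta, theta_E), a form of degree d + 1 when eta has degree d.  If
    d < n - 1 this determinant therefore vanishes, so eta = h theta_E
    ([radial_of_low_degree]), and eta in D forces Qt / Q to divide h.
    If d >= n - 1, the bound on the multiplicities is exactly what makes d at
    least the degree of theta_2.

    Exponents.  Some eta_0 of degree n - 1 satisfies det(theta_E, eta_0) = - Q and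
    lies in D when all multiplicities are 1, so eta_0(alpha_i) = rho_i alpha_i.
    Replacing eta_0 by eta_0 + h theta_E does not change the determinant and turns
    rho_i into rho_i + h.  Hence one needs a form h of degree n - 2 congruent
    to - rho_i modulo alpha_i^(m_i - 1) for all i: a Hermite interpolation
    problem with sum (m_i - 1) <= n - 2 conditions on a space of dimension n - 1,
    solvable by adding one Newton correction per condition ([homog_hermite]).
    The resulting derivation ([second_derivation]) and theta_2 = (Qt / Q) theta_E
    have determinant Qt up to sign, so they form a basis of degrees n - 1 and
    deg theta_2.

    Divisibility by a linear form is tested by restricting polynomials to its
    zero line; this restriction is a ring morphism into a domain, which makes
    linear forms prime. *)

(** * Homogeneous polynomials *)

Notation formS F := {mpoly F[2]}.

Definition mdivides (F : fieldType) (a p : formS F) : Prop := exists q, p = q * a.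

(** The subring generated by the constants and the variables is everything;
    convenient for identities that are stable under sums and products. *)
Lemma mpoly_ring_ind (n : nat) (F : fieldType) (P : {mpoly F[n]} -> Prop) :
  (forall c, P c%:MP) -> (forall i, P 'X_i) ->
  (forall p q, P p -> P q -> P (p + q)) ->
  (forall p q, P p -> P q -> P (p * q)) -> forall p, P p.
Proof.
move=> PC PX PD PM; elim/mpolyind=> [|c m p _ _ Pp]; first by rewrite -mpolyC0.
apply: (PD) => //; rewrite -mul_mpolyC; apply: (PM) => //.
rewrite mpolyXE_id.
apply: (big_ind P) => [||i _]; [by rewrite -mpolyC1 | exact: (PM) |].
elim: (m i) => [|k IHk]; first by rewrite expr0 -mpolyC1.
by rewrite exprS; apply: (PM).
Qed.

(** Taking homogeneous components commutes with multiplication by a form, so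
    the cofactor equals its own component of degree d. *)
Lemma dhomog_cofactor (n : nat) (F : fieldType) (d e : nat) (a w : {mpoly F[n]}) :
  a != 0 -> a \is e.-homog -> w * a \is (d + e).-homog -> w \is d.-homog.
Proof.
move=> a0 ha hwa.
have pi_mul k (p : {mpoly F[n]}) :
    pihomog mdeg (k + e) (p * a) = pihomog mdeg k p * a.
  rewrite (pihomog_partitionE (leqnn (mmeasure mdeg p))).
  rewrite mulr_suml !raddf_sum /= mulr_suml.
  apply: eq_bigr => j _.
  have hj : pihomog mdeg j p * a \is (j + e).-homog.
    by apply: dhomogM => //; apply: pihomogP.
  have [->|kj] := eqVneq k j.
    by rewrite pihomog_dE // pihomog_id.
  have h1 : pihomog mdeg k (pihomog mdeg j p) = 0.
    by apply: (pihomog_ne0 (d := j)); [rewrite eq_sym | apply: pihomogP].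
  rewrite h1 mul0r; apply: (pihomog_ne0 (d := (j + e)%N)) => //.
  by rewrite eqn_add2r eq_sym.
have /eqP := pi_mul d w; rewrite pihomog_dE // => /eqP/(mulIf a0) ->.
exact: pihomogP.
Qed.

Lemma dhomog_dvd_leq (n : nat) (F : fieldType) (d e : nat) (a w : {mpoly F[n]}) :
  w * a != 0 -> a \is e.-homog -> w * a \is d.-homog -> (e <= d)%N.
Proof.
move=> wa0 ha hwa.
have [w0 a0] : w != 0 /\ a != 0 by apply/andP; rewrite -negb_or -mulf_eq0.
rewrite (dhomog_uniq wa0 hwa (dhomog_msize hwa)).
rewrite (dhomog_uniq a0 ha (dhomog_msize ha)) msizeM //.
have w1 : (0 < msize w)%N by rewrite lt0n msize_poly_eq0.
move: w1; set k := msize w; set l := msize a => k0; lia.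
Qed.

(** * Restriction to a line *)

(** The form [a] vanishes on the line through the point [v], and [L] is a
    linear coordinate on that line normalised by L(v) = 1.  The last clause says
    that modulo [a] each variable equals its restriction to the line. *)
Definition line_chart (F : fieldType) (a L : formS F) (v : 'I_2 -> F) : Prop :=
  [/\ a != 0 /\ a.@[v] = 0, a \is 1.-homog, L \is 1.-homog, L.@[v] = 1 &
      forall k, mdivides a ('X_k - v k *: L)].

(** Pullback along the projection of the plane onto the line through [v] given
    by the coordinate [L].  For a chart, this is an endomorphism of the polynomial
    ring whose kernel is the ideal generated by the form that cuts out the line. *)
Definition restrict (F : fieldType) (L : formS F) (v : 'I_2 -> F) (p : formS F) :=
  p \mPo [tuple v k *: L | k < 2].

Lemma restrictM (F : fieldType) (L : formS F) v : {morph restrict L v : p q / p * q}.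
Proof. by move=> p q; rewrite /restrict rmorphM. Qed.

Lemma restrict_homog (F : fieldType) (L p : formS F) v d :
  p \is d.-homog -> restrict L v p = p.@[v] *: L ^+ d.
Proof.
move=> hp; rewrite /restrict comp_mpolyEX mevalE scaler_suml.
apply: eq_big_seq => m mp; rewrite -scalerA; congr (_ *: _).
rewrite comp_mpolyX -(dhomog_mf hp mp) /= mdegE -prodrXr -scaler_prod.
apply: eq_bigr => i _.
by rewrite tnth_mktuple exprZn.
Qed.

(** It suffices to compare the two endomorphisms on the variables, where the
    congruence is part of the chart. *)
Lemma restrict_congr (F : fieldType) (a L : formS F) v (p : formS F) :
  line_chart a L v -> mdivides a (p - restrict L v p).
Proof.
case=> _ _ _ _ hX; rewrite /restrict.
elim/mpoly_ring_ind: p => [c|i|p q [u hu] [w hw]|p q [u hu] [w hw]].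
- by exists 0; rewrite comp_mpolyC subrr mul0r.
- by rewrite comp_mpolyXU -tnth_nth tnth_mktuple.
- exists (u + w); rewrite rmorphD mulrDl -hu -hw; ring.
- exists (u * q + (p \mPo [tuple v k *: L | k < 2]) * w).
  rewrite rmorphM mulrDl -mulrA (mulrC q) mulrA -hu -mulrA -hw; ring.
Qed.

Lemma restrict_eq0_dvd (F : fieldType) (a L : formS F) v (p : formS F) :
  line_chart a L v -> restrict L v p = 0 -> mdivides a p.
Proof. by move=> ch p0; have := restrict_congr p ch; rewrite p0 subr0. Qed.

Lemma homog_root_dvd (F : fieldType) (a L : formS F) v (p : formS F) d :
  line_chart a L v -> p \is d.-homog -> p.@[v] = 0 -> mdivides a p.
Proof.
move=> ch hp p0; apply: restrict_eq0_dvd (ch) _.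
by rewrite (restrict_homog _ _ hp) p0 scale0r.
Qed.

Lemma restrict_neq0 (F : fieldType) (a L b : formS F) v d :
  line_chart a L v -> b \is d.-homog -> b.@[v] != 0 -> restrict L v b != 0.
Proof.
case=> _ _ _ L1 _ hb bv; rewrite (restrict_homog _ _ hb) scaler_eq0 negb_or bv.
apply/expf_neq0/eqP => L0.
by move/eqP: L1; rewrite L0 meval0 eq_sym oner_eq0.
Qed.

(** A linear form is prime, because restriction to its line is multiplicative
    with values in a domain and has exactly its multiples as kernel; the powers
    are then peeled off one at a time. *)
Lemma dvd_pow_cancel (F : fieldType) (a L b w : formS F) v k :
  line_chart a L v -> restrict L v b != 0 ->
  mdivides (a ^+ k) (b * w) -> mdivides (a ^+ k) w.
Proof.
move=> ch b0; elim: k w => [|k IHk] w [c hc].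
  by exists w; rewrite expr0 mulr1.
have [[a0 av] ha _ _ _] := ch.
have ra : restrict L v a = 0 by rewrite (restrict_homog _ _ ha) av scale0r.
have [w' hw'] : mdivides a w.
  apply: (restrict_eq0_dvd ch); apply/eqP; rewrite -(mulrI_eq0 _ (mulfI b0)).
  by rewrite -restrictM hc exprS !restrictM ra mul0r mulr0.
have [u hu] : mdivides (a ^+ k) w'.
  by apply: IHk; exists c; apply: (mulIf a0); rewrite -mulrA -hw' hc exprSr mulrA.
by exists u; rewrite hw' hu exprSr mulrA.
Qed.

(** * Families of distinct lines *)

Definition distinct_lines (F : fieldType) (I : finType) (a L : I -> formS F)
    (v : I -> 'I_2 -> F) : Prop :=
  (forall i, line_chart (a i) (L i) (v i)) /\
  (forall i j, j != i -> (a j).@[v i] != 0).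

Lemma meval_prod_neq0 (F : fieldType) (I : finType) (a : I -> formS F)
    (v : 'I_2 -> F) (s : seq I) (P : pred I) (k : I -> nat) :
  (forall j, j \in s -> P j -> (a j).@[v] != 0) ->
  (\prod_(j <- s | P j) a j ^+ k j).@[v] != 0.
Proof.
move=> h; rewrite rmorph_prod prodf_seq_neq0; apply/allP => j js; apply/implyP => Pj.
by rewrite rmorphXn expf_neq0 ?h.
Qed.

Lemma dhomog_pow_form (F : fieldType) (n : nat) (a : {mpoly F[n]}) k :
  a \is 1.-homog -> a ^+ k \is k.-homog.
Proof. by move=> /(dhomogMn k); rewrite mul1n. Qed.

Lemma dhomog_prod_forms (F : fieldType) (n : nat) (I : Type) (a : I -> {mpoly F[n]})
    (s : seq I) (P : pred I) (k : I -> nat) :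
  (forall i, a i \is 1.-homog) ->
  \prod_(j <- s | P j) a j ^+ k j \is (\sum_(j <- s | P j) k j).-homog.
Proof.
move=> ha; elim/big_rec2: _ => [|j d p _ hp]; first exact: dhomog1.
by apply: dhomogM => //; apply: dhomog_pow_form.
Qed.

(** The product over the forms already treated does not vanish on the next line,
    so by primality the next power divides the cofactor. *)
Lemma prod_powers_dvd (F : fieldType) (I : finType) (a L : I -> formS F) v
    (k : I -> nat) (p : formS F) :
  distinct_lines a L v -> (forall i, mdivides (a i ^+ k i) p) ->
  mdivides (\prod_i a i ^+ k i) p.
Proof.
move=> [ch nz] hp; have ha i : a i \is 1.-homog by case: (ch i).
elim: (index_enum I) (index_enum_uniq I) => [_|i s IHs /= /andP[nis us]].
  by exists p; rewrite big_nil mulr1.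
have [w hw] := IHs us.
have [u hu] : mdivides (a i ^+ k i) w.
  apply: (dvd_pow_cancel (b := \prod_(j <- s) a j ^+ k j) (ch i)).
    apply: restrict_neq0 (ch i) (dhomog_prod_forms _ _ _ ha) _.
    apply: meval_prod_neq0 => j js _; apply: nz.
    by apply: contraNneq nis => <-.
  by rewrite mulrC -hw.
by exists u; rewrite big_cons hw hu mulrA.
Qed.

Lemma prod_count (R : comNzRingType) (I : eqType) (a : I -> R) (i : I) (s : seq I) :
  \prod_(j <- s) a j = (\prod_(j <- s | j != i) a j) * a i ^+ count_mem i s.
Proof.
elim: s => [|j s IHs]; first by rewrite !big_nil mulr1.
rewrite !big_cons IHs /=; case: (eqVneq j i) => [->|_] /=.
  by rewrite add1n exprS mulrCA.
by rewrite add0n mulrA.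
Qed.

(** Hermite interpolation by forms of degree N, with one condition for each entry
    of [s].  The Newton correction for a new entry i is a multiple of the product
    A of the forms of the previous entries, which leaves the previous conditions
    intact; A is completed to degree N by a power of the coordinate L i, which
    does not vanish at the point v i. *)
Lemma homog_hermite (F : fieldType) (I : finType) (a L : I -> formS F) v
    (N : nat) (r : I -> formS F) (s : seq I) :
  distinct_lines a L v -> (forall i, r i \is N.-homog) -> (size s <= N.+1)%N ->
  exists2 h, h \is N.-homog &
    forall i, mdivides (a i ^+ count_mem i s) (h - r i).
Proof.
move=> [ch nz] hr; have ha i : a i \is 1.-homog by case: (ch i).
elim: s => [_|i s IHs sz].
  by exists 0 => [|i]; [apply: dhomog0 | exists (- r i); rewrite expr0 mulr1 sub0r].
have [h' hh' dh'] := IHs (ltnW sz).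
set A := \prod_(j <- s) a j; set k := count_mem i s.
have hA : A \is (size s).-homog.
  have := dhomog_prod_forms s predT (fun=> 1%N) ha.
  by rewrite sum1_size.
have [[a0 av] _ hL L1 _] := ch i.
set B := \prod_(j <- s | j != i) a j.
have AE : A = B * a i ^+ k by apply: prod_count.
have hak : a i ^+ k \is k.-homog by apply: dhomog_pow_form.
have ak0 : a i ^+ k != 0 by apply: expf_neq0.
have kN : (k + (N - k) = N)%N by rewrite subnKC // (leq_trans (count_size _ _)).
set T := L i ^+ (N - size s).
have hAT : A * T \is N.-homog.
  rewrite -(subnKC (_ : size s <= N)%N) //; apply: dhomogM => //.
  by apply: dhomog_pow_form.
have [u hu] := dh' i.
have Bv : B.@[v i] != 0.
  exact: (meval_prod_neq0 (fun=> 1%N) (fun j _ => nz i j)).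
have cofactor_homog w : w * a i ^+ k \is N.-homog -> w \is (N - k).-homog.
  by rewrite -{1}kN addnC; apply: dhomog_cofactor.
have hu' : u \is (N - k).-homog.
  by apply: cofactor_homog; rewrite -hu; exact: (rpredB hh' (hr i)).
have hBT : B * T \is (N - k).-homog.
  by apply: cofactor_homog; rewrite mulrAC -AE.
(* The factor a i ^ k of h' - r i and of A being removed, c is chosen to make
   the remaining form vanish at v i, hence divisible by a i once more. *)
pose c := - u.@[v i] / B.@[v i].
have [w hw] : mdivides (a i) (u + c *: (B * T)).
  apply: (homog_root_dvd (ch i) (d := (N - k)%N)).
    by apply: dhomogD => //; apply: dhomogZ.
  rewrite mevalD mevalZ mevalM /T rmorphXn /= L1 expr1n mulr1 /c.
  by rewrite mulfVK // subrr.
exists (h' + c *: (A * T)) => [|j]; first by apply: dhomogD => //; apply: dhomogZ.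
case: (eqVneq i j) => [<-|ij] /=.
  exists w; rewrite eqxx add1n exprS mulrA -hw mulrDl -hu -scalerAl.
  by rewrite AE mulrAC addrAC.
have [u' hu2] := dh' j.
exists (u' + c *: ((\prod_(j' <- s | j' != j) a j') * T)).
rewrite (negPf ij) add0n addrAC hu2 mulrDl -scalerAl [in RHS]mulrAC.
by rewrite -prod_count.
Qed.

Lemma homog_hermite_exp (F : fieldType) (I : finType) (a L : I -> formS F) v
    (N : nat) (r : I -> formS F) (k : I -> nat) :
  distinct_lines a L v -> (forall i, r i \is N.-homog) ->
  (\sum_i k i <= N.+1)%N ->
  exists2 h, h \is N.-homog & forall i, mdivides (a i ^+ k i) (h - r i).
Proof.
move=> lines hr kN; pose s := flatten [seq nseq (k i) i | i <- enum I].
have sz : size s = \sum_i k i.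
  rewrite size_flatten sumnE /shape -map_comp big_map big_enum.
  by apply: eq_bigr => i _; rewrite /= size_nseq.
have cnt i : count_mem i s = k i.
  rewrite count_flatten sumnE -map_comp big_map big_enum (bigD1 i) //=.
  rewrite count_nseq /= eqxx mul1n big1 ?addn0 // => j ji.
  by rewrite count_nseq /= (negPf ji).
have [|h hh hd] := homog_hermite (s := s) lines hr; first by rewrite sz.
by exists h => // i; rewrite -cnt.
Qed.

(** * Derivations *)

Lemma ord2P (P : 'I_2 -> Prop) : P ord0 -> P ord_max -> forall k, P k.
Proof.
move=> P0 P1 [[|[|//]] hk].
  by rewrite (_ : Ordinal hk = ord0) //; apply: val_inj.
by rewrite (_ : Ordinal hk = ord_max) //; apply: val_inj.
Qed.

Lemma mderivXU (n : nat) (F : fieldType) (i j : 'I_n) :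
  ('X_j : {mpoly F[n]})^`M(i) = (j == i)%:R%:MP.
Proof.
rewrite mderivX mnm1E; case: eqP => [->|_]; last by rewrite scale0r.
rewrite scale1r (_ : (U_(i) - U_(i))%MM = 0%MM) ?mpolyX0 //.
by apply/mnmP => k; rewrite mnmBE subnn mnm0E.
Qed.

Lemma vfield_Sx (R : realType) (f g : polyS R) : vfield f g Sx = f.
Proof. by rewrite /vfield /Sx !mderivXU /= mulr1 mulr0 addr0. Qed.

Lemma vfield_Sy (R : realType) (f g : polyS R) : vfield f g Sy = g.
Proof. by rewrite /vfield /Sy !mderivXU /= mulr1 mulr0 add0r. Qed.

Lemma vfield_derivation (R : realType) (f g : polyS R) : is_derivation (vfield f g).
Proof.
split=> [c p q|p q]; rewrite /vfield.
  by rewrite !mderivD !mderivZ !mulrDr -!scalerAr scalerDr addrACA.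
by rewrite !mderivM; ring.
Qed.

Lemma derivation_linear_comb (R : realType) (theta : polyS R -> polyS R) c d p q :
  is_derivation theta -> theta (c *: p + d *: q) = c *: theta p + d *: theta q.
Proof.
case=> lin _; have t0 : theta 0 = 0.
  by have := lin (-1) 0 0; rewrite scaler0 addr0 scaleN1r addNr.
by rewrite lin -[d *: q]addr0 lin t0 addr0.
Qed.

(** Two derivations that agree on the variables agree everywhere. *)
Lemma derivation_vfield (R : realType) (theta : polyS R -> polyS R) :
  is_derivation theta -> theta =1 vfield (theta Sx) (theta Sy).
Proof.
move=> dtheta; have [_ leib] := dtheta.
set psi := vfield _ _.
have dpsi : is_derivation psi by apply: vfield_derivation.
have [_ leib'] := dpsi.
have one0 (eta : polyS R -> polyS R) : is_derivation eta -> forall c, eta c%:MP = 0.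
  move=> de c; have e1 : eta 1 = 0.
    have := de.2 1 1; rewrite !mulr1 mul1r => /eqP.
    by rewrite -subr_eq0 opprD addNKr oppr_eq0 => /eqP.
  have -> : c%:MP = c *: 1 + 0 *: 1 :> polyS R.
    by rewrite scale0r addr0 -mul_mpolyC mulr1.
  by rewrite derivation_linear_comb // e1 scaler0 scale0r addr0.
elim/mpoly_ring_ind => [c|i|p q hp hq|p q hp hq].
- by rewrite (one0 _ dtheta) (one0 _ dpsi).
- elim/ord2P: i.
  + by rewrite -[RHS]/(psi Sx) /psi vfield_Sx.
  + by rewrite -[RHS]/(psi Sy) /psi vfield_Sy.
- have := derivation_linear_comb 1 1 p q dtheta.
  have := derivation_linear_comb 1 1 p q dpsi.
  by rewrite !scale1r => -> ->; rewrite hp hq.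
- by rewrite leib leib' hp hq.
Qed.

(** * The lines of the arrangement *)

Definition std_cx (R : realType) (n : nat) (i : 'I_n) : R[i] := (i != 1%N :> nat)%:R.
Definition std_cy (R : realType) (n : nat) (z : 'I_n -> R[i]) (i : 'I_n) : R[i] :=
  if i == 0%N :> nat then 0 else if i == 1%N :> nat then 1 else - z i.

Lemma std_formE (R : realType) (n : nat) (z : 'I_n -> R[i]) (i : 'I_n) :
  std_form z i = std_cx R i *: Sx + std_cy z i *: Sy.
Proof.
rewrite /std_form /std_cx /std_cy; case: eqP => [->|_] /=.
  by rewrite scale1r scale0r addr0.
by case: eqP => _ /=; rewrite scale1r ?scale0r ?add0r // scaleNr.
Qed.

(** The points (0, 1), (1, 0) and (z i, 1) on the lines x = 0, y = 0 and
    x = z i y, on which [std_coord] takes the value 1. *)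
Definition std_point (R : realType) (n : nat) (z : 'I_n -> R[i]) (i : 'I_n)
    (k : 'I_2) : R[i] :=
  if k == ord_max then (i != 1%N :> nat)%:R
  else if i == 0%N :> nat then 0 else if i == 1%N :> nat then 1 else z i.

Definition std_coord (R : realType) (n : nat) (i : 'I_n) : polyS R :=
  if i == 1%N :> nat then Sx else Sy.

Lemma std_form_eval (R : realType) (n : nat) (z : 'I_n -> R[i]) (i : 'I_n) v :
  (std_form z i).@[v] = std_cx R i * v ord0 + std_cy z i * v ord_max.
Proof. by rewrite std_formE mevalD !mevalZ !mevalXU. Qed.

Lemma std_coef_neq0 (R : realType) (n : nat) (z : 'I_n -> R[i]) (i : 'I_n) :
  std_cx R i != 0 \/ std_cy z i != 0.
Proof.
rewrite /std_cx /std_cy; case: (eqVneq (i : nat) 1%N) => [->|_] /=; last first.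
  by left; apply: oner_neq0.
by right; apply: oner_neq0.
Qed.

Lemma std_lines (R : realType) (n : nat) (z : 'I_n -> R[i]) :
  (forall i : 'I_n, (2 <= i)%N -> z i <> 0) ->
  (forall i j : 'I_n, (2 <= i)%N -> (2 <= j)%N -> i <> j -> z i <> z j) ->
  distinct_lines (std_form z) (@std_coord R n) (std_point z).
Proof.
have h1 k : ('X_k : polyS R) \is 1.-homog by rewrite dhomogX /= mdeg1.
have X0 : (Sx : polyS R) \is 1.-homog by apply: h1.
have Y0 : (Sy : polyS R) \is 1.-homog by apply: h1.
move=> z0 zinj; split=> [i|i j ij].
  split.
  - split; last first.
      rewrite std_form_eval /std_point /= /std_cx /std_cy.
      case: (eqVneq (i : nat) 0%N) => [->|i0] /=; first by ring.
      by case: eqP => /= _; ring.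
    (* A vanishing form would have both coefficients zero: evaluate it at the two
       coordinate points. *)
    apply/eqP => a0; have a0E (v : 'I_2 -> R[i]) :
      std_cx R i * v ord0 + std_cy z i * v ord_max = 0.
      by have := std_form_eval z i v; rewrite a0 meval0.
    have := a0E (fun k => (k == ord0)%:R); rewrite /= mulr1 mulr0 addr0 => cx0.
    have := a0E (fun k => (k == ord_max)%:R); rewrite /= mulr1 mulr0 add0r => cy0.
    by case: (std_coef_neq0 z i); rewrite ?cx0 ?cy0 eqxx.
  - by rewrite std_formE; apply: dhomogD; apply: dhomogZ.
  - by rewrite /std_coord; case: ifP.
  - rewrite /std_coord; case: ifP => i1; rewrite mevalXU /std_point /=.
      by rewrite (eqP i1).
    by rewrite i1.
  - rewrite /std_coord /std_point /std_form.
    case: eqP => [->|i0]; [|case: eqP => i1]; apply: ord2P => /=.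
    + by exists 1; rewrite mul1r scale0r subr0.
    + by exists 0; rewrite scale1r mul0r subrr.
    + by exists 0; rewrite scale1r mul0r subrr.
    + by exists 1; rewrite scale0r mul1r subr0.
    + by exists 1; rewrite mul1r.
    + by exists 0; rewrite scale1r mul0r subrr.
rewrite std_form_eval /std_point /= /std_cx /std_cy.
have big (k : 'I_n) : k != 0%N :> nat -> k != 1%N :> nat -> (1 < k)%N.
  by case: (k : nat) => [|[]].
case: (eqVneq (i : nat) 0%N) (eqVneq (j : nat) 0%N) => [i0|i0] [j0|j0].
- by case/eqP: ij; apply: val_inj; rewrite /= i0 j0.
- rewrite i0 /= mulr0 add0r mulr1; case: (eqVneq (j : nat) 1%N) => [_|j1].
    exact: oner_neq0.
  by rewrite oppr_eq0; apply/eqP; apply: z0; apply: big.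
- rewrite j0 /= mul0r addr0 mul1r; case: (eqVneq (i : nat) 1%N) => [_|i1].
    exact: oner_neq0.
  by apply/eqP; apply: z0; apply: big.
case: (eqVneq (i : nat) 1%N) (eqVneq (j : nat) 1%N) => [i1|i1] [j1|j1].
- by case/eqP: ij; apply: val_inj; rewrite /= i1 j1.
- by rewrite /= mulr0 addr0 mulr1 oner_neq0.
- by rewrite /= mul0r add0r mulr1 oner_neq0.
rewrite /= mul1r mulr1 subr_eq0; apply/eqP; apply: zinj; try exact: big.
by apply/eqP; rewrite eq_sym.
Qed.

(** * Determinants of derivations *)

Definition der_det (F : fieldType) (f1 g1 f2 g2 : formS F) := f1 * g2 - f2 * g1.

Lemma vfield_std_form (R : realType) (n : nat) (z : 'I_n -> R[i]) (i : 'I_n) f g :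
  vfield f g (std_form z i) = std_cx R i *: f + std_cy z i *: g.
Proof.
rewrite std_formE (derivation_linear_comb _ _ _ _ (vfield_derivation f g)).
by rewrite vfield_Sx vfield_Sy.
Qed.

Lemma euler_std_form (R : realType) (n : nat) (z : 'I_n -> R[i]) (h : polyS R) i :
  vfield (h * Sx) (h * Sy) (std_form z i) = h * std_form z i.
Proof. by rewrite vfield_std_form std_formE mulrDr -!scalerAr. Qed.

Lemma in_D_vfield (R : realType) (n : nat) (z : 'I_n -> R[i]) m theta :
  in_D (std_form z) m theta ->
  in_D (std_form z) m (vfield (theta Sx) (theta Sy)).
Proof.
case=> dtheta hD; split=> [|i]; first exact: vfield_derivation.
by rewrite -(derivation_vfield dtheta).
Qed.

(** If alpha_i = s x + t y, then s times the determinant is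
    theta_1(alpha_i) g2 - theta_2(alpha_i) g1, and t times the determinant is
    theta_2(alpha_i) f1 - theta_1(alpha_i) f2; one of s and t is invertible. *)
Lemma in_D_det_dvd (R : realType) (n : nat) (z : 'I_n -> R[i]) m f1 g1 f2 g2 :
  distinct_lines (std_form z) (@std_coord R n) (std_point z) ->
  in_D (std_form z) m (vfield f1 g1) -> in_D (std_form z) m (vfield f2 g2) ->
  mdivides (\prod_i std_form z i ^+ m i) (der_det f1 g1 f2 g2).
Proof.
move=> lines [_ D1] [_ D2]; apply: prod_powers_dvd lines _ => i.
have := D1 i; have := D2 i; rewrite !vfield_std_form => -[q2 e2] [q1 e1].
have unscale c (p q : polyS R) : c != 0 ->
    c *: p = q * std_form z i ^+ m i -> mdivides (std_form z i ^+ m i) p.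
  move=> c0 e; exists (c^-1 *: q).
  by rewrite -scalerAl -e scalerA mulVf // scale1r.
have [c0|c0] := std_coef_neq0 z i.
  apply: (unscale _ _ (q1 * g2 - q2 * g1) c0).
  rewrite mulrBl mulrAC -e1 mulrAC -e2 /der_det -!mul_mpolyC; ring.
apply: (unscale _ _ (q2 * f1 - q1 * f2) c0).
rewrite mulrBl mulrAC -e2 mulrAC -e1 /der_det -!mul_mpolyC; ring.
Qed.

(** Saito's criterion.  By Cramer's rule the coordinates of [eta] are quotients of
    determinants by c Qt, and these quotients are polynomials because Qt divides
    every determinant of elements of D. *)
Lemma saito_criterion (R : realType) (n : nat) (z : 'I_n -> R[i]) m f1 g1 f2 g2 c :
  distinct_lines (std_form z) (@std_coord R n) (std_point z) ->
  in_D (std_form z) m (vfield f1 g1) -> in_D (std_form z) m (vfield f2 g2) ->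
  c != 0 -> der_det f1 g1 f2 g2 = c *: \prod_i std_form z i ^+ m i ->
  basis_of_D (std_form z) m (vfield f1 g1) (vfield f2 g2).
Proof.
move=> lines D1 D2 c0 detE; split=> // eta hD.
have etaE := derivation_vfield hD.1.
have {hD} hD := in_D_vfield hD.
set f := eta Sx in etaE hD; set g := eta Sy in etaE hD.
set Qt := \prod_i _ in detE.
have Qt0 : Qt != 0.
  by apply/prodf_neq0 => i _; apply: expf_neq0; case: (lines.1 i) => -[].
have [A hA] := in_D_det_dvd lines hD D2.
have [B hB] := in_D_det_dvd lines D1 hD.
rewrite -/Qt /der_det in hA hB detE.
have solve u u1 u2 : u * (c *: Qt) = (A * Qt) * u1 + (B * Qt) * u2 ->
    u = (c^-1 *: A) * u1 + (c^-1 *: B) * u2.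
  move=> e; apply: (mulIf (x := c *: Qt)); first by rewrite scaler_eq0 negb_or c0.
  rewrite e mulrDl -!scalerAl -!scalerAr !scalerA mulVf // !scale1r.
  ring.
have fE : f = (c^-1 *: A) * f1 + (c^-1 *: B) * f2.
  by apply: solve; rewrite -hA -hB -detE; ring.
have gE : g = (c^-1 *: A) * g1 + (c^-1 *: B) * g2.
  by apply: solve; rewrite -hA -hB -detE; ring.
exists (c^-1 *: A, c^-1 *: B); split=> [p|[a b] /= hab].
  by rewrite etaE /= /vfield fE gE; ring.
have := hab Sx; rewrite !vfield_Sx -/f => fab.
have := hab Sy; rewrite !vfield_Sy -/g => gab.
have cQ u v : v * Qt = u * (c *: Qt) -> c^-1 *: v = u.
  rewrite -scalerAr scalerAl => /(mulIf Qt0) ->.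
  by rewrite scalerA mulVf // scale1r.
by congr (_, _); apply: cQ; rewrite -?hA -?hB -detE fab gab; ring.
Qed.

(** * Derivations of low degree and of degree n - 1 *)

(** The product of the n forms divides the determinant of the given derivation
    and the Euler derivation, whose degree d + 1 is less than n; so the
    determinant f y - x g vanishes.  As f is the value on the form x, it is
    divisible by x, and the vanishing determinant gives g the same cofactor. *)
Lemma radial_of_low_degree (R : realType) (n : nat) (z : 'I_n -> R[i])
    (m : 'I_n -> nat) f g d :
  distinct_lines (std_form z) (@std_coord R n) (std_point z) ->
  (0 < n)%N -> (forall i, (0 < m i)%N) ->
  in_D (std_form z) m (vfield f g) ->
  f \is d.-homog -> g \is d.-homog -> (d < n - 1)%N ->
  exists h, f = h * Sx /\ g = h * Sy.
Proof.
move=> lines n0 m_pos [dfg D] hf hg dn.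
have Dred : in_D (std_form z) (fun=> 1%N) (vfield f g).
  split=> // i; have [q hq] := D i; exists (q * std_form z i ^+ (m i).-1).
  by rewrite hq -mulrA -exprD addn1 prednK.
have Deul : in_D (std_form z) (fun=> 1%N) (vfield Sx Sy).
  split=> [|i]; first exact: vfield_derivation.
  by exists 1; rewrite -[Sx]mul1r -[Sy]mul1r euler_std_form expr1.
have [w hw] := in_D_det_dvd lines Dred Deul.
have ha i : std_form z i \is 1.-homog by case: (lines.1 i).
have h1 k : ('X_k : polyS R) \is 1.-homog by rewrite dhomogX /= mdeg1.
have det0 : der_det f g Sx Sy = 0.
  apply/eqP; apply: contraLR dn => det0; rewrite -leqNgt.
  have hdet : der_det f g Sx Sy \is (d + 1).-homog.
    apply: (rpredB (dhomogM hf (h1 _))).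
    by rewrite addnC; apply: (dhomogM (h1 _) hg).
  rewrite hw in det0 hdet.
  have := dhomog_dvd_leq det0 (dhomog_prod_forms _ _ _ ha) hdet.
  by rewrite sum1_card card_ord; lia.
have [u hu] := D (Ordinal n0).
rewrite /std_form /= vfield_Sx in hu.
exists (u * Sx ^+ (m (Ordinal n0)).-1).
have fE : f = u * Sx ^+ (m (Ordinal n0)).-1 * Sx.
  by rewrite -mulrA -exprSr prednK.
split=> //; have x0 : (Sx : polyS R) != 0.
  by have [[]] := lines.1 (Ordinal n0).
apply: (mulIf x0); move/eqP: det0; rewrite /der_det subr_eq0 {1}fE => /eqP.
by move=> e; rewrite [LHS]mulrC -e; ring.
Qed.

(** Start from x P d/dx, where P is the product of all forms but x and y: it
    sends every form to a multiple of itself, and its determinant with the Euler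
    derivation is - x y P.  Adding a multiple h of the Euler derivation preserves
    the determinant, and Hermite interpolation provides an h for which the values
    on the forms vanish to the prescribed orders. *)
Lemma second_derivation (R : realType) (n : nat) (z : 'I_n -> R[i])
    (m : 'I_n -> nat) :
  distinct_lines (std_form z) (@std_coord R n) (std_point z) ->
  (2 <= n)%N -> (forall i, (0 < m i)%N) -> (\sum_(i < n) (m i).-1 <= n - 1)%N ->
  exists f g, [/\ f \is (n - 1).-homog, g \is (n - 1).-homog,
    in_D (std_form z) m (vfield f g) &
    der_det Sx Sy f g = - \prod_i std_form z i].
Proof.
move=> lines n2 m_pos hsum.
pose i0 : 'I_n := Ordinal (ltnW n2); pose i1 : 'I_n := Ordinal n2.
have ha i : std_form z i \is 1.-homog by case: (lines.1 i).
have a0 i : std_form z i != 0 by case: (lines.1 i) => -[].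
have hx : (Sx : polyS R) \is 1.-homog := ha i0.
have hy : (Sy : polyS R) \is 1.-homog := ha i1.
have nE : (n - 1 = n - 2 + 1)%N by lia.
pose P := \prod_(i | (i != i0) && (i != i1)) std_form z i.
have QE : \prod_i std_form z i = P * (Sx * Sy).
  by rewrite (bigD1 i0) //= (bigD1 i1) //= mulrA mulrC.
have hP : P \is (n - 2).-homog.
  apply: (@dhomog_cofactor _ _ _ 2 (Sx * Sy)).
  - by apply: mulf_neq0; [apply: (a0 i0) | apply: (a0 i1)].
  - exact: (dhomogM hx hy).
  have := dhomog_prod_forms (index_enum 'I_n) predT (fun=> 1%N) ha.
  by rewrite sum1_card card_ord subnK // -QE.
have hrho i : exists rho, std_cx R i *: (Sx * P) = rho * std_form z i.
  have [->|ii0] := eqVneq i i0.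
    by exists P; rewrite /std_cx /std_form /= scale1r mulrC.
  have [->|ii1] := eqVneq i i1; first by exists 0; rewrite /std_cx /= scale0r mul0r.
  exists (std_cx R i *:
    (Sx * \prod_(j | (j != i0) && (j != i1) && (j != i)) std_form z j)).
  by rewrite /P (bigD1 i) ?ii0 //= -scalerAl mulrAC mulrA.
have [rho rhoE] := fin_all_exists hrho.
have rho_homog i : - rho i \is (n - 2).-homog.
  rewrite dhomogN; apply: (dhomog_cofactor (a0 i) (ha i)).
  by rewrite -rhoE addnC; apply: dhomogZ; apply: dhomogM.
have [|h hh hd] := homog_hermite_exp (k := fun i => (m i).-1) lines rho_homog.
  by apply: leq_trans hsum _; lia.
exists (Sx * P + h * Sx), (h * Sy); split.
- rewrite nE; apply: dhomogD; last exact: dhomogM.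
  by rewrite addnC; apply: dhomogM.
- by rewrite nE; apply: dhomogM.
- split=> [|i]; first exact: vfield_derivation.
  have [w hw] := hd i; exists w.
  have -> : vfield (Sx * P + h * Sx) (h * Sy) (std_form z i) =
            std_cx R i *: (Sx * P) + vfield (h * Sx) (h * Sy) (std_form z i).
    by rewrite !vfield_std_form scalerDr addrA.
  rewrite euler_std_form rhoE -mulrDl addrC -[rho i]opprK hw.
  by rewrite -mulrA -exprSr prednK.
by rewrite QE /der_det; ring.
Qed.

(** * Exponents of the multi-arrangement *)

Theorem mainTheorem3 (R : realType) (n : nat) (m : 'I_n -> nat)
    (z : 'I_n -> R[i])
    (hn : (2 <= n)%N)
    (m_pos : forall i, (0 < m i)%N)
    (m_noninc : forall i j : 'I_n, (i <= j)%N -> (m j <= m i)%N)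
    (z_neq0 : forall i : 'I_n, (2 <= i)%N -> z i <> 0)
    (z_inj : forall i j : 'I_n, (2 <= i)%N -> (2 <= j)%N -> i <> j ->
       z i <> z j)
    (hsum : (\sum_(i < n) m i <= 2 * n - 2)%N) :
  let alpha := std_form z in
  let Qt := \prod_(i < n) alpha i ^+ m i in
  let Q := \prod_(i < n) alpha i in
  exists2 q, Qt = q * Q &
    let theta2 := fun p => q * euler_der p in
    [/\ in_D alpha m theta2,
        min_degree_in_D alpha m theta2 &
        has_exponents alpha m (\sum_(i < n) m i - n + 1)%N (n - 1)%N].
Proof.
move=> alpha Qt Q.
have lines := std_lines z_neq0 z_inj; rewrite -/alpha in lines.
have ha i : alpha i \is 1.-homog by case: (lines.1 i).
have a0 i : alpha i != 0 by case: (lines.1 i) => -[].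
have n0 : (0 < n)%N by apply: ltnW.
have hx : (Sx : polyS R) \is 1.-homog := ha (Ordinal n0).
have hy : (Sy : polyS R) \is 1.-homog := ha (Ordinal hn).
have x0 : (Sx : polyS R) != 0 := a0 (Ordinal n0).
pose q := \prod_i alpha i ^+ (m i).-1.
have QtE : Qt = q * Q.
  rewrite /Qt /q /Q -big_split /=; apply: eq_bigr => i _.
  by rewrite -exprSr prednK.
have sumE : (\sum_i (m i).-1 + n = \sum_i m i)%N.
  transitivity (\sum_i ((m i).-1 + 1))%N.
    by rewrite big_split /= sum1_card card_ord.
  by apply: eq_bigr => i _; rewrite addn1 prednK.
have degE : (\sum_i m i - n = \sum_i (m i).-1)%N by rewrite -sumE addnK.
have deg_q : (\sum_i (m i).-1 <= n - 2)%N.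
  by rewrite -degE; apply: leq_trans (leq_sub2r n hsum) _; lia.
rewrite degE {degE sumE hsum}.
have hq : q \is (\sum_i (m i).-1).-homog by apply: dhomog_prod_forms.
have q0 : q != 0 by apply/prodf_neq0 => i _; apply: expf_neq0.
exists q => // theta2.
have theta2E : theta2 =1 vfield (q * Sx) (q * Sy).
  by move=> p; rewrite /theta2 /euler_der /vfield mulrDr !mulrA.
have Dq : in_D alpha m (vfield (q * Sx) (q * Sy)).
  split=> [|i]; first exact: vfield_derivation.
  exists (\prod_(j | j != i) alpha j ^+ (m j).-1).
  rewrite euler_std_form -/alpha /q (bigD1 i) //= mulrAC -exprSr prednK //.
  exact: mulrC.
have D2 : in_D alpha m theta2.
  split=> [|i]; last by rewrite theta2E; apply: Dq.2.
  have [lin leib] := vfield_derivation (q * Sx) (q * Sy).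
  by split=> [c p r|p r]; rewrite !theta2E; [apply: lin | apply: leib].
have h2 : homog_der (\sum_i (m i).-1 + 1) theta2.
  exists (q * Sx), (q * Sy); split=> //; [exact: dhomogM | exact: dhomogM |].
  by rewrite (mulf_neq0 q0 x0).
split=> //.
  exists (\sum_i (m i).-1 + 1)%N; split=> // eta d Deta [f [g [etaE hf hg fg0]]].
  rewrite leqNgt; apply/negP => d_small.
  have Dfg : in_D alpha m (vfield f g).
    split=> [|i]; first exact: vfield_derivation.
    by rewrite -etaE; apply: Deta.2.
  have dn : (d < n - 1)%N by lia.
  have [h [fE gE]] := radial_of_low_degree lines n0 m_pos Dfg hf hg dn.
  have [w hw] : mdivides q h.
    apply: (prod_powers_dvd lines) => i; have [u hu] := Dfg.2 i.
    exists u; apply: (mulIf (a0 i)).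
    by rewrite -mulrA -exprSr prednK // -hu fE gE euler_std_form.
  suff : (\sum_i (m i).-1 + 1 <= d)%N by lia.
  rewrite fE in fg0 hf; rewrite gE in fg0 hg; rewrite hw -!mulrA in fg0 hf hg.
  by case/orP: fg0 => nz; apply: (dhomog_dvd_leq nz) => //; apply: dhomogM.
split; first by lia.
have [|f [g [hf hg Dfg detE]]] := second_derivation lines hn m_pos.
  by apply: leq_trans deg_q _; lia.
exists (vfield (q * Sx) (q * Sy)), (vfield f g); split.
- apply: (saito_criterion (c := -1) lines) => //.
    by rewrite oppr_eq0 oner_eq0.
  rewrite -/Qt QtE scaleN1r -mulrN -detE /der_det; ring.
- by case: h2 => f2 [g2 [e *]]; exists f2, g2; split=> // p; rewrite -theta2E.
- exists f, g; split=> //; apply: contraTT isT; rewrite negb_or !negbK.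
  case/andP=> /eqP f0 /eqP g0.
  have : \prod_i alpha i != 0 by apply/prodf_neq0 => i _.
  by rewrite -[\prod_i _]opprK -detE f0 g0 /der_det mulr0 mul0r subrr oppr0 eqxx.
Qed.
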